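(* Let $d\ge 2$, $n\ge 1$, $m\in\mathbb{N}$, and let $L^\alpha$ ($\alpha$ a multi-index in $d$ variables, $0\le|\alpha|\le m$) be constant real $n\times n$ matrices. Assume that the system $U_t+\sum_{0\le|\alpha|\le m}L^\alpha D^\alpha U=0$ is symbol symmetrizable, with symbol symmetrizer $S=S(\xi)$, and let $A(\xi)$, $B(\xi)$ be its generalized transport and generalized viscosity symbols. Then the following conditions are equivalent: (i) the system is strictly dissipative; (ii) the system is genuinely coupled; (iii) there exists a compensating matrix symbol for the triplet $(S,A,B)$.
   Context: Here $U=U(x,t)\in\mathbb{R}^n$, $x\in\mathbb{R}^d$, $t\ge0$. For $\xi\in\mathbb{R}^d\setminus\{0\}$ put $\omega=\xi/|\xi|$ and $$A(\xi)=\sum_{1\le|\alpha|\le m,\ |\alpha|\text{ odd}}|\xi|^{|\alpha|-1}(-1)^{(|\alpha|-1)/2}\omega^\alpha L^\alpha,\qquad B(\xi)=\sum_{0\le|\alpha|\le m,\ |\alpha|\text{ even}}|\xi|^{|\alpha|}(-1)^{|\alpha|/2}\omega^\alpha L^\alpha,$$ so that the Fourier transform of the system is $\widehat U_t+i|\xi|A(\xi)\widehat U+B(\xi)\widehat U=0$. Strictly dissipative: for every $\xi\in\mathbb{R}^d\setminus\{0\}$, every $\lambda\in\mathbb{C}$ for which $(\lambda I_n+i|\xi|A(\xi)+B(\xi))v=0$ has a solution $v\in\mathbb{C}^n\setminus\{0\}$ satisfies $\mathrm{Re}\,\lambda<0$. Symbol symmetrizable: there is $S\in C^\infty(\mathbb{R}^d\setminus\{0\};\mathbb{R}^{n\times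 n})$ with $S(\xi)$ symmetric positive definite, $S(\xi)A(\xi)$ and $S(\xi)B(\xi)$ symmetric, and $S(\xi)B(\xi)\ge0$ (positive semi-definite), for all $\xi\ne0$. Such an $S$ is called a symbol symmetrizer. Genuinely coupled: for every $\xi\in\mathbb{R}^d\setminus\{0\}$, $(\mu I_n+A(\xi))\psi\ne0$ for every $\mu\in\mathbb{R}$ and every $\psi\in\ker B(\xi)$, $\psi\ne0$. Compensating matrix symbol for $(S,A,B)$: a function $K\in C^\infty(\mathbb{R}^d\setminus\{0\};\mathbb{R}^{n\times n})$ such that for all $\xi\neq0$: (a) $K(\xi)S(\xi)$ is skew-symmetric; (b) $[K(\xi)S(\xi)A(\xi)]^s+S(\xi)B(\xi)\ge\theta(\xi)I_n$ for some $\theta(\xi)>0$, where $[M]^s=\frac12(M+M^\top)$. *)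

(* Defs.v *)
From HB Require Import structures.
From mathcomp Require Import all_boot all_order all_algebra.
From mathcomp Require Import all_classical all_reals all_analysis.
From mathcomp Require Import complex.
From mathcomp Require mpoly.
(* The notations of mpoly clash with those of MathComp-Analysis.
   [bmultinom d m.+1] is the finite type of the multi-indices in [d] variables
   of total degree [< m.+1], and [mdeg] is the total degree. *)
Import -(notations) mpoly.

Set Implicit Arguments.
Unset Strict Implicit.
Unset Printing Implicit Defensive.

Import Order.TTheory GRing.Theory Num.Theory.
Import numFieldNormedType.Exports.

Local Open Scope classical_set_scope.
Local Open Scope ring_scope.
Local Open Scope complex_scope.

(* The norm [`|x|] of MathComp-Analysis on row vectors is the sup norm. *)
Definition enorm (R : realType) (d : nat) (x : 'rV[R]_d) : R :=
  Num.sqrt (\sum_(i < d) x ord0 i ^+ 2).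

Definition direction (R : realType) (d : nat) (x : 'rV[R]_d) : 'rV[R]_d :=
  (enorm x)^-1 *: x.

Definition monomial (R : realType) (d m : nat) (x : 'rV[R]_d)
    (a : bmultinom d m.+1) : R :=
  \prod_(i < d) x ord0 i ^+ a i.

Definition transport_symbol (R : realType) (d n m : nat)
    (L : bmultinom d m.+1 -> 'M[R]_n) (xi : 'rV[R]_d) : 'M[R]_n :=
  \sum_(a : bmultinom d m.+1 | odd (mdeg a))
    (enorm xi ^+ (mdeg a).-1 * (-1) ^+ ((mdeg a).-1)./2
       * monomial (direction xi) a) *: L a.

Definition viscosity_symbol (R : realType) (d n m : nat)
    (L : bmultinom d m.+1 -> 'M[R]_n) (xi : 'rV[R]_d) : 'M[R]_n :=
  \sum_(a : bmultinom d m.+1 | ~~ odd (mdeg a))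
    (enorm xi ^+ mdeg a * (-1) ^+ (mdeg a)./2
       * monomial (direction xi) a) *: L a.

(* [partials [:: i1; ...; ik] f] is d_i1 ... d_ik f. *)
Definition partials (R : realType) (d : nat) (s : seq 'I_d)
    (f : 'rV[R]_d -> R) : 'rV[R]_d -> R :=
  foldr (fun i g x => 'D_(delta_mx ord0 i) g x) f s.

(* C^oo on the open set [D]: the iterated partial derivatives of every order
   exist and are continuous at the points of [D].  As [D] is open, the values
   of [f] outside [D] are irrelevant. *)
Definition smooth_on (R : realType) (d : nat) (D : set 'rV[R]_d)
    (f : 'rV[R]_d -> R) : Prop :=
  forall (s : seq 'I_d) (x : 'rV[R]_d), D x ->
    {for x, continuous (partials s f)} /\
    forall i : 'I_d, derivable (partials s f) x (delta_mx ord0 i).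

Definition smooth_mx_away0 (R : realType) (d n : nat)
    (F : 'rV[R]_d -> 'M[R]_n) : Prop :=
  forall i j : 'I_n, smooth_on [set xi | xi != 0] (fun xi => F xi i j).

Definition qform (R : realType) (n : nat) (M : 'M[R]_n) (v : 'cV[R]_n) : R :=
  (v^T *m M *m v) ord0 ord0.

Definition posdefmx (R : realType) (n : nat) (M : 'M[R]_n) : Prop :=
  M^T = M /\ forall v : 'cV[R]_n, v != 0 -> 0 < qform M v.

Definition possemidefmx (R : realType) (n : nat) (M : 'M[R]_n) : Prop :=
  M^T = M /\ forall v : 'cV[R]_n, 0 <= qform M v.

Definition sympart (R : realType) (n : nat) (M : 'M[R]_n) : 'M[R]_n :=
  2^-1 *: (M + M^T).

Definition complexmx (R : realType) (p q : nat) (M : 'M[R]_(p, q)) :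
    'M[R[i]]_(p, q) :=
  map_mx (real_complex R) M.

Definition strictly_dissipative (R : realType) (d n m : nat)
    (L : bmultinom d m.+1 -> 'M[R]_n) : Prop :=
  forall xi : 'rV[R]_d, xi != 0 ->
  forall lambda : R[i],
    (exists v : 'cV[R[i]]_n, v != 0 /\
       (lambda%:M + ('i%C * (enorm xi)%:C) *: complexmx (transport_symbol L xi)
          + complexmx (viscosity_symbol L xi)) *m v = 0) ->
    complex.Re lambda < 0.

Definition symbol_symmetrizer (R : realType) (d n m : nat)
    (L : bmultinom d m.+1 -> 'M[R]_n) (S : 'rV[R]_d -> 'M[R]_n) : Prop :=
  smooth_mx_away0 S /\
  forall xi : 'rV[R]_d, xi != 0 ->
    [/\ posdefmx (S xi),
        (S xi *m transport_symbol L xi)^T = S xi *m transport_symbol L xi,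
        (S xi *m viscosity_symbol L xi)^T = S xi *m viscosity_symbol L xi
      & possemidefmx (S xi *m viscosity_symbol L xi)].

Definition genuinely_coupled (R : realType) (d n m : nat)
    (L : bmultinom d m.+1 -> 'M[R]_n) : Prop :=
  forall xi : 'rV[R]_d, xi != 0 ->
  forall (mu : R) (psi : 'cV[R]_n),
    viscosity_symbol L xi *m psi = 0 -> psi != 0 ->
    (mu%:M + transport_symbol L xi) *m psi != 0.

(* The order M >= theta I of symmetric matrices is the positive
   semi-definiteness of M - theta I. *)
Definition compensating_symbol (R : realType) (d n : nat)
    (S A B K : 'rV[R]_d -> 'M[R]_n) : Prop :=
  smooth_mx_away0 K /\
  forall xi : 'rV[R]_d, xi != 0 ->
    (K xi *m S xi)^T = - (K xi *m S xi) /\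
    exists theta : R, 0 < theta /\
      possemidefmx (sympart (K xi *m S xi *m A xi) + S xi *m B xi - theta%:M).

(* Main.v *)
(** The equivalence of (i) and (ii) is an energy identity: for an eigenvector [v]
    of eigenvalue [lambda], the real part of [v^* S (lambda + i |xi| A + B) v = 0]
    is [Re lambda * v^* S v + v^* S B v = 0].  A compensating matrix excludes an
    eigenvector [psi] of [A] in [ker B], since [psi^T K S A psi] vanishes.

    Conversely, put [M = S B].  As [A] is [S]-symmetric, genuine coupling is the
    Kalman condition: no [v <> 0] satisfies [M A^k v = 0] for all [k < n].  With
    weights [e_k = eta ^ (k (2n - k))], the skew-symmetric matrix
      [W = sum_(1 <= k < n) e_k ((A^k)^T M A^(k-1) - (A^(k-1))^T M A^k)]
    gives [v^T (W A + M) v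
      = sum_(k < n) e_k |A^k v|_M^2
        - sum_(1 <= k < n) e_k <A^(k-1) v, A^(k+1) v>_M],
    which is positive for small [eta].  An explicit admissible [eta] is a smooth
    function of [A] and [M], so [K = W S^-1] is smooth and no partition of unity
    is needed. *)
Require Import Defs.
From mathcomp Require Import all_boot all_order all_algebra.
From mathcomp Require Import all_classical all_reals all_analysis.
From mathcomp Require Import complex.
From mathcomp Require mpoly.
Import -(notations) mpoly.
From mathcomp Require Import ring lra zify.

Set Implicit Arguments.
Unset Strict Implicit.
Unset Printing Implicit Defensive.

Import Order.TTheory GRing.Theory Num.Theory.
Import numFieldNormedType.Exports.

Local Open Scope classical_set_scope.
Local Open Scope ring_scope.

(** * Smooth functions *)

Section Smooth.
Context (R : realType) (d : nat) (D : set 'rV[R]_d) (openD : open D).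

(* The partial derivative of a generated function is generated, so that all the
   iterated partial derivatives exist without a Leibniz or chain rule of higher
   order. *)
Inductive smooth_gen : ('rV[R]_d -> R) -> Prop :=
| smooth_gen_smooth f : smooth_on D f -> smooth_gen f
| smooth_gen_cst c : smooth_gen (cst c)
| smooth_gen_coord i : smooth_gen (fun x => x ord0 i)
| smooth_genD f g : smooth_gen f -> smooth_gen g -> smooth_gen (f + g)
| smooth_genM f g : smooth_gen f -> smooth_gen g -> smooth_gen (f * g)
| smooth_genV f : (forall x, D x -> f x != 0) -> smooth_gen f ->
    smooth_gen (fun x => (f x)^-1)
| smooth_gen_sqrt f : (forall x, D x -> 0 < f x) -> smooth_gen f ->
    smooth_gen (fun x => Num.sqrt (f x))
| smooth_gen_eq f g : (forall x, D x -> f x = g x) -> smooth_gen f ->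
    smooth_gen g.

Lemma near_D x : D x -> \near x, D x.
Proof. by move=> Dx; exact: open_nbhs_nbhs. Qed.

Lemma is_derive_sqrt_comp (f : 'rV[R]_d -> R) (x v : 'rV[R]_d) :
  0 < f x -> derivable f x v ->
  is_derive x v (fun y => Num.sqrt (f y)) ((2 * Num.sqrt (f x))^-1 * 'D_v f x).
Proof.
move=> fx0 dfx.
(* Restricting to the line through [x] in the direction [v] reduces the claim to
   the chain rule in one variable. *)
pose g (t : R) := f (t *: v + x).
have g0 : g 0 = f x by rewrite /g scale0r add0r.
have dg : is_derive (0 : R) 1 g ('D_v f x).
  have E : forall h : R, g (h *: 1 + 0) - g 0 = (f \o shift x) (h *: v) - f x.
    by move=> h; rewrite g0 /g addr0 /= [h *: 1]mulr1.
  split; first by rewrite /derivable /=; under eq_fun do rewrite E.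
  by rewrite /derive /=; under eq_fun do rewrite E.
have ds : is_derive (g 0) 1 (@Num.sqrt R) (2 * Num.sqrt (f x))^-1.
  by rewrite g0; exact: is_derive1_sqrt.
have := @is_derive1_comp R _ g 0 _ _ ds dg.
set F := _ \o g => -[dF DF].
have E : forall h : R, F (h *: 1 + 0) - F 0 =
  ((fun y => Num.sqrt (f y)) \o shift x) (h *: v) - Num.sqrt (f x).
  by move=> h; rewrite /F /= g0 /g addr0 /= [h *: 1]mulr1.
split.
  by move: dF; rewrite /derivable /=; under eq_fun do rewrite E.
by rewrite -DF [RHS]/derive /=; under [in RHS]eq_fun do rewrite E.
Qed.

(** [partials] applies the last index of the list first, so appending [i] to the list differentiates
    [f] along [i] beforehand. *)
Lemma smooth_on_partial (f : 'rV[R]_d -> R) (i : 'I_d) :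
  smooth_on D f -> smooth_on D ('D_(delta_mx ord0 i) f).
Proof.
move=> sf s x Dx; have := sf (rcons s i) x Dx.
by rewrite /partials foldr_rcons.
Qed.

(** Induction on the generation: each differentiation rule expresses the derivative through
    generators. The formulas hold only on [D], hence the use of [smooth_gen_eq]. *)
Lemma smooth_gen_partial f : smooth_gen f ->
  (forall x, D x -> {for x, continuous f}) /\
  forall i, (forall x, D x -> derivable f x (delta_mx ord0 i)) /\
    smooth_gen ('D_(delta_mx ord0 i) f).
Proof.
elim=> {f}.
- move=> f sf; split=> [x Dx|i]; first exact: (sf [::] x Dx).1.
  split=> [x Dx|]; first exact: (sf [::] x Dx).2.
  by apply: smooth_gen_smooth; exact: smooth_on_partial.
- move=> c; split=> [x Dx|i]; first exact: cst_continuous.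
  split=> [x Dx|]; first exact: derivable_cst.
  apply: (smooth_gen_eq _ (smooth_gen_cst 0)) => x Dx.
  by rewrite derive_cst.
- move=> i; split=> [x Dx|j]; first exact: coord_continuous.
  set e : 'rV[R]_d := delta_mx ord0 j.
  have H (x : 'rV[R]_d) :
      is_derive x e (fun x : 'rV[R]_d => x ord0 i) (e ord0 i).
    have [dg Dg] : is_derive (0 : R) 1 (fun t : R => t * e ord0 i) (e ord0 i).
      have -> : (fun t : R => t * e ord0 i) = (id * cst (e ord0 i))%R by [].
      by apply: is_derive_eq; rewrite /cst /= scaler0 add0r [_ *: 1]mulr1.
    have E (h : R) : (h *: 1 + 0) * e ord0 i - 0 * e ord0 i =
        ((fun x : 'rV[R]_d => x ord0 i) \o shift x) (h *: e) - x ord0 i.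
      by rewrite /= !mxE mul0r subr0 addr0 addrK [h *: 1]mulr1.
    split; first by move: dg; rewrite /derivable /=; under eq_fun do rewrite E.
    by rewrite -[RHS]Dg [RHS]/derive /=; under [in RHS]eq_fun do rewrite E.
  split=> [x Dx|]; first by case: (H x).
  apply: (smooth_gen_eq _ (smooth_gen_cst (e ord0 i))) => x Dx.
  by case: (H x).
- move=> f g sf [cf df] sg [cg dg]; split=> [x Dx|i].
    by apply: continuousD; [exact: cf|exact: cg].
  have [{}df sDf] := df i; have [{}dg sDg] := dg i.
  split=> [x Dx|]; first by apply: derivableD; [exact: df|exact: dg].
  apply: (smooth_gen_eq _ (smooth_genD sDf sDg)) => x Dx.
  by rewrite deriveD //; [exact: df|exact: dg].
- move=> f g sf [cf df] sg [cg dg]; split=> [x Dx|i].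
    by apply: continuousM; [exact: cf|exact: cg].
  have [{}df sDf] := df i; have [{}dg sDg] := dg i.
  split=> [x Dx|]; first by apply: derivableM; [exact: df|exact: dg].
  apply: (smooth_gen_eq _
    (smooth_genD (smooth_genM sf sDg) (smooth_genM sg sDf))) => x Dx.
  by rewrite deriveM //; [exact: df|exact: dg].
- move=> f f0 sf [cf df]; split=> [x Dx|i].
    by apply: continuousV; [exact: f0|exact: cf].
  have [{}df sDf] := df i.
  split=> [x Dx|]; first by apply: derivableV; [exact: f0|exact: df].
  have sV := smooth_genV f0 sf.
  apply: (smooth_gen_eq _ (smooth_genM (smooth_genM (smooth_gen_cst (- 1))
    (smooth_genM sV sV)) sDf)) => x Dx.
  rewrite deriveV; [|exact: f0|exact: df].
  rewrite /GRing.mul /= -[X in X = _]/(-1 * ((f x)^-1 * (f x)^-1) * _).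
  by rewrite mulN1r -expr2 exprVn.
- move=> f f0 sf [cf df]; split=> [x Dx|i].
    by apply: (continuous_comp (cf x Dx)); exact: sqrt_continuous.
  have [{}df sDf] := df i.
  have H x (Dx : D x) := is_derive_sqrt_comp (f0 x Dx) (df x Dx).
  split=> [x Dx|]; first by case: (H x Dx).
  have h0 x : D x -> (cst 2 * (fun x => Num.sqrt (f x)))%R x != 0.
    move=> Dx; have := f0 x Dx; rewrite -sqrtr_gt0 => s0.
    by rewrite mulf_neq0 // ?gt_eqF.
  apply: (smooth_gen_eq _ (smooth_genM (smooth_genV h0
    (smooth_genM (smooth_gen_cst 2) (smooth_gen_sqrt f0 sf))) sDf)) => x Dx.
  by case: (H x Dx) => _ ->.
- move=> f g fg sf [cf df].
  (* As [D] is open, equality on [D] is equality near each of its points. *)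
  have nfg x : D x -> {near x, f =1 g}.
    by move=> /near_D; apply: filterS => y; exact: fg.
  split=> [x Dx|i].
    have := cf x Dx; rewrite /continuous_at /prop_for -(fg x Dx).
    by apply: cvg_trans; apply: (@near_eq_cvg _ _ (nbhs x)) (nfg x Dx).
  have [{}df sDf] := df i.
  split=> [x Dx|]; first exact: near_eq_derivable (nfg x Dx) (df x Dx).
  apply: (smooth_gen_eq _ sDf) => x Dx.
  apply: near_eq_derive. exact: (nfg x Dx).
Qed.

Lemma smooth_gen_smooth_on f : smooth_gen f -> smooth_on D f.
Proof.
move=> sf s x Dx.
have {sf} : smooth_gen (partials s f).
  by elim: s => [//|i s IH]; have [_ /(_ i)[]] := smooth_gen_partial IH.
move=> /smooth_gen_partial[cf df]; split; first exact: cf.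
by move=> i; exact: (df i).1.
Qed.

End Smooth.

(** * Matrices with smooth entries *)

Section SmoothMx.
Context (R : realType) (d : nat) (D : set 'rV[R]_d).

Definition smooth_genmx (p q : nat) (F : 'rV[R]_d -> 'M[R]_(p, q)) : Prop :=
  forall i j, smooth_gen D (fun x => F x i j).

Lemma smooth_gen_sum (I : Type) (r : seq I) (P : pred I)
    (f : I -> 'rV[R]_d -> R) :
  (forall i, P i -> smooth_gen D (f i)) ->
  smooth_gen D (fun x => \sum_(i <- r | P i) f i x).
Proof.
move=> sf.
have -> : (fun x => \sum_(i <- r | P i) f i x) = \sum_(i <- r | P i) f i.
  by apply/funext => x; rewrite fct_sumE.
apply: big_ind => //; first exact: smooth_gen_cst.
exact: smooth_genD.
Qed.

Lemma smooth_gen_prod (I : Type) (r : seq I) (P : pred I)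
    (f : I -> 'rV[R]_d -> R) :
  (forall i, P i -> smooth_gen D (f i)) ->
  smooth_gen D (fun x => \prod_(i <- r | P i) f i x).
Proof.
move=> sf; elim: r => [|i r IH].
  by under eq_fun do rewrite big_nil; exact: smooth_gen_cst.
under eq_fun do rewrite big_cons.
by case: (P i) (sf i) => // sfi; apply: smooth_genM IH; exact: sfi.
Qed.

Lemma smooth_genX (f : 'rV[R]_d -> R) k :
  smooth_gen D f -> smooth_gen D (fun x => f x ^+ k).
Proof.
move=> sf; elim: k => [|k IH].
  by under eq_fun do rewrite expr0; exact: smooth_gen_cst.
by under eq_fun do rewrite exprS; exact: smooth_genM.
Qed.

Lemma smooth_genmx_sum (p q : nat) (I : Type) (r : seq I) (P : pred I)
    (F : I -> 'rV[R]_d -> 'M[R]_(p, q)) :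
  (forall i, P i -> smooth_genmx (F i)) ->
  smooth_genmx (fun x => \sum_(i <- r | P i) F i x).
Proof.
move=> sF i j; under eq_fun do rewrite summxE.
by apply: smooth_gen_sum => k Pk; exact: sF.
Qed.

Lemma smooth_genmx_cst (p q : nat) (M : 'M[R]_(p, q)) :
  smooth_genmx (fun=> M).
Proof. by move=> i j; exact: smooth_gen_cst. Qed.

Lemma smooth_genmx_scale (p q : nat) f (F : 'rV[R]_d -> 'M[R]_(p, q)) :
  smooth_gen D f -> smooth_genmx F -> smooth_genmx (fun x => f x *: F x).
Proof.
by move=> sf sF i j; under eq_fun do rewrite mxE; exact: smooth_genM.
Qed.

Lemma smooth_genmx_sub (p q : nat) (F G : 'rV[R]_d -> 'M[R]_(p, q)) :
  smooth_genmx F -> smooth_genmx G -> smooth_genmx (fun x => F x - G x).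
Proof.
move=> sF sG i j; under eq_fun do rewrite !mxE -mulN1r.
by apply: smooth_genD => //; apply: smooth_genM => //; exact: smooth_gen_cst.
Qed.

Lemma smooth_genmx_mul (p q r : nat) (F : 'rV[R]_d -> 'M[R]_(p, q))
    (G : 'rV[R]_d -> 'M[R]_(q, r)) :
  smooth_genmx F -> smooth_genmx G -> smooth_genmx (fun x => F x *m G x).
Proof.
move=> sF sG i j; under eq_fun do rewrite mxE.
by apply: smooth_gen_sum => k _; exact: smooth_genM.
Qed.

Lemma smooth_genmx_tr (p q : nat) (F : 'rV[R]_d -> 'M[R]_(p, q)) :
  smooth_genmx F -> smooth_genmx (fun x => (F x)^T).
Proof. by move=> sF i j; under eq_fun do rewrite mxE; exact: sF. Qed.

Lemma smooth_genmxX (p : nat) (F : 'rV[R]_d -> 'M[R]_p) k :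
  smooth_genmx F -> smooth_genmx (fun x => F x ^+ k).
Proof.
move=> sF; elim: k => [|k IH].
  by under eq_fun do rewrite expr0; exact: smooth_genmx_cst.
by under eq_fun do rewrite exprS; exact: smooth_genmx_mul.
Qed.

Lemma smooth_gen_det (p : nat) (F : 'rV[R]_d -> 'M[R]_p) :
  smooth_genmx F -> smooth_gen D (fun x => \det (F x)).
Proof.
move=> sF; apply: smooth_gen_sum => s _.
apply: smooth_genM; first exact: smooth_gen_cst.
by apply: smooth_gen_prod => i _; exact: sF.
Qed.

(** Cramer's rule writes the entries of the inverse as cofactors over the determinant. *)
Lemma smooth_genmx_inv (p : nat) (F : 'rV[R]_d -> 'M[R]_p) :
  (forall x, D x -> F x \in unitmx) -> smooth_genmx F ->
  smooth_genmx (fun x => invmx (F x)).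
Proof.
move=> uF sF i j.
have detF x : D x -> \det (F x) != 0.
  by move=> /uF; rewrite unitmxE unitfE.
apply: (@smooth_gen_eq _ _ _ (fun x => (\det (F x))^-1 * cofactor (F x) j i)).
  by move=> x Dx; rewrite /invmx uF // !mxE.
apply: smooth_genM; first exact: smooth_genV (smooth_gen_det sF).
apply: smooth_genM; first exact: smooth_gen_cst.
apply: smooth_gen_det => k l; under eq_fun do rewrite !mxE; exact: sF.
Qed.

(** The squared Frobenius norm is polynomial in the entries, so bounds built from it stay smooth. *)
Definition sqnormmx (p q : nat) (M : 'M[R]_(p, q)) : R :=
  \sum_i \sum_j M i j ^+ 2.

Lemma smooth_gen_sqnormmx (p q : nat) (F : 'rV[R]_d -> 'M[R]_(p, q)) :
  smooth_genmx F -> smooth_gen D (fun x => sqnormmx (F x)).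
Proof.
move=> sF; apply: smooth_gen_sum => i _; apply: smooth_gen_sum => j _.
exact/smooth_genX/sF.
Qed.

End SmoothMx.

(** * Smoothness of the transport and viscosity symbols *)

Section Symbols.
Context (R : realType) (d n m : nat) (L : bmultinom d m.+1 -> 'M[R]_n).
Let D := [set xi : 'rV[R]_d | xi != 0].

Lemma sum_sqr_gt0 (xi : 'rV[R]_d) : xi != 0 ->
  0 < \sum_(i < d) xi ord0 i ^+ 2.
Proof.
move=> xi0; have s0 i : true -> 0 <= xi ord0 i ^+ 2 by rewrite sqr_ge0.
rewrite lt_neqAle sumr_ge0 // andbT eq_sym psumr_eq0 //.
apply: contra xi0 => /allP xi0; apply/eqP/rowP => i.
by have := xi0 i (mem_index_enum i); rewrite sqrf_eq0 mxE => /eqP.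
Qed.

Lemma enorm_gt0 (xi : 'rV[R]_d) : xi != 0 -> 0 < enorm xi.
Proof. by rewrite sqrtr_gt0; exact: sum_sqr_gt0. Qed.

Lemma smooth_gen_enorm : smooth_gen D (@enorm R d).
Proof.
apply: smooth_gen_sqrt; first exact: sum_sqr_gt0.
by apply: smooth_gen_sum => i _; exact/smooth_genX/smooth_gen_coord.
Qed.

Lemma smooth_gen_monomial (a : bmultinom d m.+1) :
  smooth_gen D (fun xi => monomial (direction xi) a).
Proof.
apply: smooth_gen_prod => i _; apply: smooth_genX.
under eq_fun do rewrite mxE.
apply: smooth_genM (smooth_gen_coord _ _); apply: smooth_genV smooth_gen_enorm.
by move=> x /enorm_gt0/lt0r_neq0.
Qed.

Lemma smooth_transport_symbol : smooth_genmx D (transport_symbol L).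
Proof.
apply: smooth_genmx_sum => a _; apply: smooth_genmx_scale (smooth_genmx_cst _ _).
apply: smooth_genM (smooth_gen_monomial a).
apply: smooth_genM (smooth_gen_cst _ _); exact: smooth_genX smooth_gen_enorm.
Qed.

Lemma smooth_viscosity_symbol : smooth_genmx D (viscosity_symbol L).
Proof.
apply: smooth_genmx_sum => a _; apply: smooth_genmx_scale (smooth_genmx_cst _ _).
apply: smooth_genM (smooth_gen_monomial a).
apply: smooth_genM (smooth_gen_cst _ _); exact: smooth_genX smooth_gen_enorm.
Qed.

End Symbols.

(** * Quadratic forms *)

Section QuadraticForms.
Context (R : realType) (n : nat).
Implicit Types (M P : 'M[R]_n) (u v w : 'cV[R]_n).

Definition bform M u v : R := (u^T *m M *m v) ord0 ord0.

Lemma bformE M u v : bform M u v = (u^T *m (M *m v)) ord0 ord0.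
Proof. by rewrite mulmxA. Qed.

Lemma bformC M u v : M^T = M -> bform M u v = bform M v u.
Proof.
move=> MT; rewrite /bform.
have -> : v^T *m M *m u = (u^T *m M *m v)^T.
  by rewrite !trmx_mul trmxK MT mulmxA.
by rewrite [RHS]mxE.
Qed.

Lemma bform_shift M u v (t : R) : M^T = M ->
  qform M (u + t *: v) = qform M u + 2 * t * bform M u v + t ^+ 2 * qform M v.
Proof.
move=> MT; rewrite /qform.
have -> : (u + t *: v)^T = u^T + t *: v^T by apply/matrixP => i j; rewrite !mxE.
rewrite mulmxDr !mulmxDl -!scalemxAr -!scalemxAl.
have D (A B : 'M[R]_1) : (A + B) ord0 ord0 = A ord0 ord0 + B ord0 ord0.
  by rewrite mxE.
have Z (a : R) (A : 'M[R]_1) : (a *: A) ord0 ord0 = a * A ord0 ord0.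
  by rewrite mxE.
rewrite !(D, Z).
rewrite -/(bform M u v) -/(bform M v u) (bformC v u MT).
ring.
Qed.

(** The polynomial [qform M (u + t v)] in [t] is nonnegative. *)
Lemma possemidef_cauchy_schwarz M u v : possemidefmx M ->
  bform M u v ^+ 2 <= qform M u * qform M v.
Proof.
move=> [MT M0].
set b := bform M u v; set p := qform M u; set q := qform M v.
have H t : 0 <= p + 2 * t * b + t ^+ 2 * q by rewrite -bform_shift.
have [q0|q0] := eqVneq q 0.
  rewrite q0 mulr0 exprn_even_le0 //=; apply: contrapT => /negP b0.
  (* For [q = 0] and [b <> 0] the polynomial is affine, and this [t] gives it the value [-1]. *)
  have := H (- (p + 1) / (2 * b)).
  rewrite q0 mulr0 addr0.
  have -> : 2 * (- (p + 1) / (2 * b)) * b = - (p + 1) by field.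
  lra.
have {}q0 : 0 < q by rewrite lt_neqAle eq_sym q0 M0.
(* The minimum of the quadratic polynomial. *)
have := H (- b / q).
have -> : p + 2 * (- b / q) * b + (- b / q) ^+ 2 * q = (p * q - b ^+ 2) / q.
  by field; rewrite gt_eqF.
by rewrite pmulr_lge0 ?invr_gt0 // subr_ge0.
Qed.

Lemma sqnormmx_ge0 p q (M : 'M[R]_(p, q)) : 0 <= sqnormmx M.
Proof. by apply: sumr_ge0 => i _; apply: sumr_ge0 => j _; exact: sqr_ge0. Qed.

Lemma sqnormmx_cV v : (v^T *m v) ord0 ord0 = sqnormmx v.
Proof.
by rewrite mxE; apply: eq_bigr => i _; rewrite big_ord1 mxE -expr2.
Qed.

Lemma sqnormmx_cV_gt0 v : v != 0 -> 0 < sqnormmx v.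
Proof.
move=> v0; rewrite lt_neqAle sqnormmx_ge0 andbT eq_sym.
apply: contra v0; rewrite /sqnormmx psumr_eq0; last first.
  by move=> i _; apply: sumr_ge0 => j _; exact: sqr_ge0.
move=> /allP v0; apply/eqP/colP => i; have := v0 i (mem_index_enum i).
by rewrite big_ord1 mxE sqrf_eq0 => /eqP.
Qed.

Lemma possemidef1 : possemidefmx (1%:M : 'M[R]_n).
Proof.
split=> [|v]; first exact: trmx1.
by rewrite /qform mulmx1 sqnormmx_cV sqnormmx_ge0.
Qed.

(** Cauchy-Schwarz for [M v] and [v] bounds [|M v|^4] by a multiple of [qform M v]. *)
Lemma possemidef_qform_eq0 M v : possemidefmx M -> qform M v = 0 -> M *m v = 0.
Proof.
move=> M0 qv0; apply/eqP; apply: contrapT => /negP/sqnormmx_cV_gt0.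
have := possemidef_cauchy_schwarz (M *m v) v M0.
rewrite qv0 mulr0 exprn_even_le0 //= bformE sqnormmx_cV => /eqP ->.
by rewrite ltxx.
Qed.

Lemma sqnormmx_mul M v : sqnormmx (M *m v) <= sqnormmx M * sqnormmx v.
Proof.
rewrite {1 2}/sqnormmx mulr_suml; apply: ler_sum => i _; rewrite big_ord1.
have := possemidef_cauchy_schwarz (row i M)^T v possemidef1.
rewrite /bform /qform !mulmx1 !sqnormmx_cV trmxK -row_mul mxE.
congr (_ <= _ * _); apply: eq_bigr => j _; by rewrite big_ord1 !mxE.
Qed.

(** Expanding [|v - M v|^2 >= 0] bounds [2 v^T M v] by [|v|^2 + |M v|^2]; no square root enters the
    constant. *)
Lemma qform_le M v : qform M v <= (1 + sqnormmx M) * sqnormmx v.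
Proof.
have : 0 <= qform 1%:M (v - M *m v) by have [_] := possemidef1; exact.
rewrite -scaleN1r bform_shift ?trmx1 //.
rewrite /qform /bform !mulmx1 !sqnormmx_cV mulmxA -/(qform M v).
have := sqnormmx_mul M v; have := sqnormmx_ge0 M; have := sqnormmx_ge0 v.
set a := sqnormmx v; set b := sqnormmx M; set c := sqnormmx _.
move=> a0 b0 cab; nra.
Qed.

(** For positive definite [P] this dominates the reciprocal of the smallest eigenvalue, yet it is
    rational in the entries of [P]. *)
Definition coercivity_bound P : R := sqnormmx (invmx P) * (1 + sqnormmx P).

Lemma coercivity_bound_ge0 P : 0 <= coercivity_bound P.
Proof. by rewrite mulr_ge0 ?addr_ge0 ?sqnormmx_ge0. Qed.

Lemma posdef_semidef P : posdefmx P -> possemidefmx P.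
Proof.
move=> [PT P0]; split=> // v; have [->|/P0/ltW //] := eqVneq v 0.
by rewrite /qform mulmx0 mxE.
Qed.

Lemma posdef_unit P : posdefmx P -> P \in unitmx.
Proof.
move=> [PT P0]; rewrite -row_free_unit; apply: inj_row_free => v vP.
have [//|v0] := eqVneq v 0.
have /P0 : v^T != 0 by rewrite trmx_eq0.
by rewrite /qform trmxK vP mul0mx mxE ltxx.
Qed.

(** With [w = P v], [|v|^2 <= |P^-1|^2 |w|^2]. Cauchy-Schwarz gives [|w|^4 = (w^T P v)^2 <= (w^T P
    w) (v^T P v)], and after [qform_le] a factor [|w|^2] cancels. *)
Lemma posdef_coercive P v : posdefmx P ->
  sqnormmx v <= coercivity_bound P * qform P v.
Proof.
move=> P0; have uP := posdef_unit P0; have sP := posdef_semidef P0.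
have := sqnormmx_mul (invmx P) (P *m v); rewrite mulKmx // => /le_trans; apply.
rewrite /coercivity_bound -mulrA ler_wpM2l ?sqnormmx_ge0 //.
set w := P *m v.
have [->|w0] := eqVneq w 0.
  apply: (@le_trans _ _ 0).
    by rewrite /sqnormmx big1 // => i _; rewrite big1 // => j _; rewrite mxE expr0n.
  by rewrite mulr_ge0 ?addr_ge0 ?sqnormmx_ge0 // sP.2.
rewrite -(ler_pM2l (sqnormmx_cV_gt0 w0)) -expr2.
have -> : sqnormmx w = bform P w v by rewrite bformE sqnormmx_cV.
apply: le_trans (possemidef_cauchy_schwarz _ _ sP) _.
rewrite bformE sqnormmx_cV mulrA [sqnormmx w * _]mulrC.
by rewrite ler_wpM2r ?qform_le // sP.2.
Qed.

Lemma qform_sub_scalar P (t : R) v :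
  qform (P - t%:M) v = qform P v - t * sqnormmx v.
Proof.
rewrite /qform mulmxBr mulmxBl mul_mx_scalar -scalemxAl -sqnormmx_cV.
by rewrite [LHS]mxE; congr (_ + _); rewrite mxE; congr (- _); rewrite mxE.
Qed.

Lemma posdef_lower_bound P : posdefmx P ->
  exists theta : R, 0 < theta /\ possemidefmx (P - theta%:M).
Proof.
move=> P0; exists (1 + coercivity_bound P)^-1.
have c0 : 0 < 1 + coercivity_bound P.
  by rewrite ltr_pwDl ?coercivity_bound_ge0.
split; first by rewrite invr_gt0.
split=> [|v]; first by rewrite linearB /= tr_scalar_mx P0.1.
rewrite qform_sub_scalar subr_ge0 ler_pdivrMl //.
apply: le_trans (posdef_coercive _ P0) _.
by rewrite ler_wpM2r ?(posdef_semidef P0).2 // lerDr ler01.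
Qed.

End QuadraticForms.

(** * Observability *)

Section ComplexMatrices.
Context (R : realType).
Implicit Types (p q r : nat).

Definition Remx p q (M : 'M[R[i]]_(p, q)) : 'M[R]_(p, q) :=
  map_mx (@complex.Re R) M.

Definition Immx p q (M : 'M[R[i]]_(p, q)) : 'M[R]_(p, q) :=
  map_mx (@complex.Im R) M.

Lemma Remx_mul p q r (M : 'M[R]_(p, q)) (N : 'M[R[i]]_(q, r)) :
  Remx (complexmx M *m N) = M *m Remx N.
Proof.
apply/matrixP => i j; rewrite !mxE raddf_sum; apply: eq_bigr => k _.
by rewrite !mxE; case: (N k j) => a b /=; rewrite mul0r subr0.
Qed.

Lemma Immx_mul p q r (M : 'M[R]_(p, q)) (N : 'M[R[i]]_(q, r)) :
  Immx (complexmx M *m N) = M *m Immx N.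
Proof.
apply/matrixP => i j; rewrite !mxE raddf_sum; apply: eq_bigr => k _.
by rewrite !mxE; case: (N k j) => a b /=; rewrite mul0r addr0.
Qed.

Lemma Remx_scale p q (z : R[i]) (M : 'M[R[i]]_(p, q)) :
  Remx (z *: M) = complex.Re z *: Remx M - complex.Im z *: Immx M.
Proof. by apply/matrixP => i j; rewrite !mxE; case: z (M i j) => a b []. Qed.

Lemma Immx_scale p q (z : R[i]) (M : 'M[R[i]]_(p, q)) :
  Immx (z *: M) = complex.Re z *: Immx M + complex.Im z *: Remx M.
Proof. by apply/matrixP => i j; rewrite !mxE; case: z (M i j) => a b []. Qed.

Lemma RemxD p q (M N : 'M[R[i]]_(p, q)) : Remx (M + N) = Remx M + Remx N.
Proof. by apply/matrixP => i j; rewrite !mxE raddfD. Qed.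

Lemma ImmxD p q (M N : 'M[R[i]]_(p, q)) : Immx (M + N) = Immx M + Immx N.
Proof. by apply/matrixP => i j; rewrite !mxE raddfD. Qed.

Lemma complexmx_eq0 p q (M : 'M[R[i]]_(p, q)) :
  (M == 0) = (Remx M == 0) && (Immx M == 0).
Proof.
apply/eqP/andP => [->|[/eqP M0 /eqP M1]].
  by split; apply/eqP/matrixP => i j; rewrite !mxE.
apply/matrixP => i j; move/matrixP/(_ i j): M0; move/matrixP/(_ i j): M1.
by rewrite !mxE; case: (M i j) => a b /= -> ->.
Qed.

End ComplexMatrices.

(* A product of linear factors of [A] kills [v]; applying the factors one at a
   time, the last nonzero vector is an eigenvector. *)
Lemma eigenvector_in_kernel (F : fieldType) n p (A : 'M[F]_n.+1)
    (B : 'M[F]_(p, n.+1)) (s : seq F) (v : 'cV[F]_n.+1) :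
  v != 0 ->
  (forall j, (j < size s)%N -> B *m (A ^+ j *m v) = 0) ->
  horner_mx A (\prod_(z <- s) ('X - z%:P)) *m v = 0 ->
  exists z (w : 'cV_n.+1), [/\ w != 0, A *m w = z *: w & B *m w = 0].
Proof.
elim: s v => [|z s IH] v v0 Bv.
  by rewrite big_nil rmorph1 mul1mx => /eqP; rewrite (negbTE v0).
rewrite big_cons mulrC rmorphM rmorphB /= horner_mx_X horner_mx_C.
rewrite -mulmxE -mulmxA.
have Ev : (A - z%:M) *m v = A *m v - z *: v by rewrite mulmxBl mul_scalar_mx.
have [w0 _|w0] := eqVneq ((A - z%:M) *m v) 0.
  exists z, v; split=> //; first by apply/eqP; rewrite -subr_eq0 -Ev w0.
  by have := Bv 0%N isT; rewrite expr0 mul1mx.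
apply: IH => // j js.
(* Removing a factor costs one power of [A], in step with the shorter list of roots. *)
have -> : A ^+ j *m ((A - z%:M) *m v) = A ^+ j.+1 *m v - z *: (A ^+ j *m v).
  by rewrite Ev mulmxBr -scalemxAr mulmxA exprSr.
by rewrite mulmxBr -scalemxAr !Bv ?scaler0 ?subr0 //= ltnW.
Qed.

(** * From genuine coupling to the Kalman condition *)

Section Kalman.
Context (R : realType) (n : nat).
Implicit Types (S A B : 'M[R]_n.+1).

Lemma bform_scaler S u v (a : R) : bform S u (a *: v) = a * bform S u v :> R.
Proof. by rewrite /bform -scalemxAr mxE. Qed.

Lemma bformDr S (u v w : 'cV[R]_n.+1) :
  bform S u (v + w) = bform S u v + bform S u w :> R.
Proof. by rewrite /bform mulmxDr mxE. Qed.

(** The equations say that [x + i y] is an eigenvector of [A] for [a + i b], and [A] is self-adjoint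
    for the inner product of [S]. *)
Lemma symmetrized_eigenvector_real S A (x y : 'cV[R]_n.+1) (a b : R) :
  posdefmx S -> (S *m A)^T = S *m A -> (x != 0) || (y != 0) ->
  A *m x = a *: x - b *: y -> A *m y = a *: y + b *: x -> b = 0.
Proof.
move=> S0 SA xy Ax Ay.
have E u v : bform (S *m A) u v = bform S u (A *m v).
  by rewrite /bform !mulmxA.
(* Compare [x^T S A y] with [y^T S A x]. *)
have := bformC x y SA; rewrite !E Ax Ay -scaleNr !bformDr !bform_scaler.
rewrite (bformC y x S0.1).
have q0 : 0 < bform S x x + bform S y y.
  case/orP: xy => /(S0.2) ?; [apply: ltr_pwDl => //|apply: ltr_wpDl => //];
  exact: (posdef_semidef S0).2.
move=> H; have : b * (bform S x x + bform S y y) = 0 by lra.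
by move/eqP; rewrite mulf_eq0 (gt_eqF q0) orbF => /eqP.
Qed.

(** By Cayley-Hamilton the linear factors of the complex characteristic polynomial kill [v], so
    [v <> 0] yields a complex eigenvector in [ker B]. Its eigenvalue is real, and its real or
    imaginary part is a real eigenvector that coupling forbids. *)
Lemma coupled_observable S A B (v : 'cV[R]_n.+1) :
  posdefmx S -> (S *m A)^T = S *m A ->
  (forall (mu : R) (psi : 'cV_n.+1),
     B *m psi = 0 -> psi != 0 -> (mu%:M + A) *m psi != 0) ->
  (forall j, (j < n.+1)%N -> B *m (A ^+ j *m v) = 0) -> v = 0.
Proof.
move=> S0 SA coupled Bv; have [//|v0] := eqVneq v 0.
have [s Es] := closed_field_poly_normal (char_poly (complexmx A)).
have := Es; rewrite (monicP (char_poly_monic _)) scale1r => {}Es.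
have size_s : size s = n.+1.
  have := size_char_poly (complexmx A).
  by rewrite Es size_prod_XsubC => -[].
have [|j js||z [w [w0 Aw Bw]]] :=
  @eigenvector_in_kernel _ _ _ (complexmx A) (complexmx B) s (complexmx v).
- by rewrite map_mx_eq0.
- rewrite -[RHS](map_mx0 (real_complex R)) -(Bv j) -?size_s //.
  by rewrite /complexmx !map_mxM rmorphXn.
- by rewrite -Es Cayley_Hamilton mul0mx.
have Ax : A *m Remx w = complex.Re z *: Remx w - complex.Im z *: Immx w.
  by rewrite -Remx_mul Aw Remx_scale.
have Ay : A *m Immx w = complex.Re z *: Immx w + complex.Im z *: Remx w.
  by rewrite -Immx_mul Aw Immx_scale.
have Bx : B *m Remx w = 0 by rewrite -Remx_mul Bw; apply/matrixP => i j; rewrite !mxE.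
have By : B *m Immx w = 0 by rewrite -Immx_mul Bw; apply/matrixP => i j; rewrite !mxE.
move: w0; rewrite complexmx_eq0 negb_and => xy.
have z0 := symmetrized_eigenvector_real S0 SA xy Ax Ay.
have K (u : 'cV_n.+1) : B *m u = 0 -> A *m u = complex.Re z *: u -> u != 0 -> False.
  move=> Bu Au /(coupled (- complex.Re z) _ Bu).
  by rewrite mulmxDl mul_scalar_mx Au scaleNr addNr eqxx.
rewrite z0 !scale0r subr0 addr0 in Ax Ay.
by case/orP: xy => [/(K _ Bx Ax)|/(K _ By Ay)].
Qed.

End Kalman.

(** * Weights with concave exponents *)

Lemma weight_exponent_gap (k N : nat) : (k < N)%N ->
  ((k * (N.*2 - k)).+1 <= N * (N.*2 - N))%N.
Proof.
(* This removes truncated subtraction. As [k (2N - k) = N^2 - (N - k)^2], the exponents differ by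
   [(j + 1)^2]. *)
move=> kN; have [j ->] : exists j, N = (k + j.+1)%N by exists (N - k.+1)%N; lia.
have -> : ((k + j.+1).*2 - k = k + j.+1.*2)%N by lia.
have -> : ((k + j.+1).*2 - (k + j.+1) = k + j.+1)%N by lia.
by have := leq0n (j * j); lia.
Qed.

(** The exponent is quadratic in [k] with second difference [-2]. *)
Lemma weight_exponent_concave (k N : nat) : (k.+1 < N)%N ->
  (k.+1 * (N.*2 - k.+1) * 2 =
   2 + (k * (N.*2 - k) + k.+2 * (N.*2 - k.+2)))%N.
Proof.
move=> kN; have [j ->] : exists j, N = (k + j.+2)%N by exists (N - k.+2)%N; lia.
have -> : ((k + j.+2).*2 - k.+1 = k + j.*2 + 3)%N by lia.
have -> : ((k + j.+2).*2 - k = k + j.*2 + 4)%N by lia.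
have -> : ((k + j.+2).*2 - k.+2 = k + j.*2 + 2)%N by lia.
lia.
Qed.

Section WeightedSum.
Context (R : realFieldType) (n : nat) (eta C : R) (q c : nat -> R).

Definition compensator_weight (N : nat) (t : R) (k : nat) : R :=
  t ^+ (k * (N.*2 - k)).

Let eps := compensator_weight n.+1 eta.

(* [eps k ^+ 2 = eta ^+ 2 * eps k.-1 * eps k.+1] (the exponents are strictly
   concave in [k]), so every cross term is at most [eta] times the weighted sum
   of the [q k]. *)
Lemma weighted_sum_gt0 :
  (forall k, 0 <= q k) -> (forall k, c k ^+ 2 <= q k * q k.+2) ->
  0 <= C -> q n.+1 <= C * \sum_(k < n.+1) q k -> 0 < \sum_(k < n.+1) q k ->
  0 < eta -> eta * (n.+1%:R + C) <= 1 ->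
  0 < q 0%N + \sum_(i < n) eps i.+1 * (q i.+1 - c i).
Proof.
move=> q0 cq C0 qn sq0 eta0 etaC.
have n0 : 0 <= n%:R :> R by rewrite ler0n.
(* The summands of [eta (n + 1 + C) <= 1] bound [eta], [eta C] and, strictly since [eta > 0],
   [n eta]. *)
rewrite -natr1 !mulrDr mulr1 in etaC.
have en0 := mulr_ge0 (ltW eta0) n0; have eC0 := mulr_ge0 (ltW eta0) C0.
have eta1 : eta <= 1 by lra.
have etaC1 : eta * C <= 1 by lra.
have etan : n%:R * eta < 1 by rewrite mulrC; lra.
have eps0 k : 0 < eps k by exact: exprn_gt0.
have epsN k : (k < n.+1)%N -> eps n.+1 <= eta * eps k.
  move=> kn; rewrite /eps /compensator_weight -exprS.
  apply: ler_wiXn2l; rewrite ?(ltW eta0) //.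
  exact: weight_exponent_gap.
pose F := \sum_(k < n.+1) eps k * q k.
have F_ge : eps n.+1 * \sum_(k < n.+1) q k <= eta * F.
  rewrite /F !mulr_sumr; apply: ler_sum => k _.
  by rewrite mulrA ler_wpM2r // epsN.
have F0 : 0 < F.
  by rewrite -(pmulr_rgt0 _ eta0); apply: lt_le_trans F_ge; rewrite mulr_gt0.
(* For [k <= n] this is a summand of [F]. The term [k = n + 1] lies outside [F] and is absorbed by
   the bound on [q n.+1] and [eta C <= 1]. *)
have qF k : (k <= n.+1)%N -> eps k * q k <= F.
  rewrite leq_eqVlt => /predU1P[->|kn].
    apply: (@le_trans _ _ (C * (eps n.+1 * \sum_(k < n.+1) q k))).
      by rewrite mulrCA ler_wpM2l // ltW.
    apply: (@le_trans _ _ (C * (eta * F))); first by rewrite ler_wpM2l.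
    by rewrite mulrA [C * _]mulrC ler_piMl // ltW.
  rewrite /F (bigD1 (Ordinal kn)) //= lerDl; apply: sumr_ge0 => i _.
  by rewrite mulr_ge0 // ltW.
have cF (i : 'I_n) : eps i.+1 * c i <= eta * F.
  have E : eps i.+1 ^+ 2 = eta ^+ 2 * (eps i * eps i.+2).
    rewrite /eps /compensator_weight -exprM -!exprD; congr (_ ^+ _).
    exact/weight_exponent_concave/ltn_ord.
  have : (eps i.+1 * c i) ^+ 2 <= (eta * F) ^+ 2.
    rewrite exprMn E [leRHS]exprMn.
    apply: (@le_trans _ _ (eta ^+ 2 * ((eps i * q i) * (eps i.+2 * q i.+2)))).
      rewrite -[leLHS]mulrA ler_wpM2l ?sqr_ge0 // [leRHS]mulrACA ler_wpM2l //.
      by rewrite mulr_ge0 // ltW.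
    rewrite ler_wpM2l ?sqr_ge0 // expr2 ler_pM ?mulr_ge0 ?qF ?(ltW (eps0 _)) ?ltnS //.
    exact: leqW (ltnW (ltn_ord i)).
  (* [c i] has no sign: the squares are compared only when the cross term exceeds [eta F > 0]. *)
  have [//|lt] := lerP (eps i.+1 * c i) (eta * F).
  have /ltW eF0 : 0 < eta * F by rewrite mulr_gt0.
  by rewrite leNgt ltr_pXn2r // ?nnegrE ?lt // (le_trans eF0 (ltW lt)).
have FE : F = q 0%N + \sum_(i < n) eps i.+1 * q i.+1.
  by rewrite /F big_ord_recl /eps /compensator_weight mul0n expr0 mul1r.
under eq_bigr do rewrite mulrBr.
rewrite sumrB addrA -FE subr_gt0.
apply: (@le_lt_trans _ _ (\sum_(i < n) eta * F)); first exact: ler_sum.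
rewrite sumr_const card_ord -mulr_natl mulrA; nra.
Qed.

End WeightedSum.

(** * The compensating matrix *)

Section Compensator.
Context (R : realType) (n : nat).
Implicit Types (A M X Y : 'M[R]_n.+1) (v : 'cV[R]_n.+1).

Lemma qformD X Y v : qform (X + Y) v = qform X v + qform Y v.
Proof. by rewrite /qform mulmxDr mulmxDl mxE. Qed.

Lemma qformZ (a : R) X v : qform (a *: X) v = a * qform X v.
Proof. by rewrite /qform -scalemxAr -scalemxAl mxE. Qed.

Lemma qform_sum (I : Type) (r : seq I) (F : I -> 'M[R]_n.+1) v :
  qform (\sum_(i <- r) F i) v = \sum_(i <- r) qform (F i) v.
Proof.
apply: (big_morph (fun X => qform X v)) => [X Y|]; first exact: qformD.
by rewrite /qform mulmx0 mul0mx mxE.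
Qed.

Lemma qform_tr X v : qform X^T v = qform X v.
Proof.
rewrite /qform; have -> : v^T *m X^T *m v = (v^T *m X *m v)^T.
  by rewrite !trmx_mul trmxK mulmxA.
by rewrite [LHS]mxE.
Qed.

Lemma qform_sympart X v : qform (sympart X) v = qform X v.
Proof. by rewrite qformZ qformD qform_tr; field. Qed.

Lemma sympart_sym X : (sympart X)^T = sympart X.
Proof. by apply/matrixP => i j; rewrite !mxE addrC. Qed.

Lemma qform_congr A M k l v :
  qform ((A ^+ k)^T *m M *m A ^+ l) v = bform M (A ^+ k *m v) (A ^+ l *m v).
Proof. by rewrite /qform /bform trmx_mul !mulmxA. Qed.

(** The observability Gramian of the pair [(A, M)]. *)
Definition gramian A M : 'M[R]_n.+1 :=
  \sum_(k < n.+1) (A ^+ k)^T *m M *m A ^+ k.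

(* Positive definiteness of the Gramian makes this smooth function of [A] and
   [M] a bound for [qform M (A ^+ n.+1 *m v)] in terms of the lower powers. *)
Definition power_bound A M : R :=
  (1 + sqnormmx ((A ^+ n.+1)^T *m M *m A ^+ n.+1))
    * coercivity_bound (gramian A M).

(** The parameter [eta]: equality in the smallness condition of [weighted_sum_gt0], with
    [C = power_bound A M]. *)
Definition compensator_scale A M : R := (n.+1%:R + power_bound A M)^-1.

(** The matrix [W], with [k = i + 1] running from 1 to [n] for matrices of size [n + 1]. *)
Definition skew_compensator A M : 'M[R]_n.+1 :=
  \sum_(i < n) compensator_weight n.+1 (compensator_scale A M) i.+1 *:
    ((A ^+ i.+1)^T *m M *m A ^+ i - (A ^+ i)^T *m M *m A ^+ i.+1).

Lemma skew_compensator_skew A M : M^T = M ->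
  (skew_compensator A M)^T = - skew_compensator A M.
Proof.
move=> MT; rewrite /skew_compensator raddf_sum -sumrN; apply: eq_bigr => i _.
rewrite -scalerN opprB [LHS]linearZ /= [(_ - _)^T]linearB /=.
by rewrite !trmx_mul !trmxK MT !mulmxA.
Qed.

Lemma qform_gramian A M v :
  qform (gramian A M) v = \sum_(k < n.+1) qform M (A ^+ k *m v).
Proof. by rewrite qform_sum; apply: eq_bigr => k _; rewrite qform_congr. Qed.

(** If the form vanishes at [v], so does each nonnegative term [qform M (A^k v)]; then [M A^k v = 0]
    by semi-definiteness. *)
Lemma gramian_posdef A M : possemidefmx M ->
  (forall v, (forall j, (j < n.+1)%N -> M *m (A ^+ j *m v) = 0) -> v = 0) ->
  posdefmx (gramian A M).
Proof.
move=> M0 obs; split=> [|v v0].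
  rewrite /gramian raddf_sum; apply: eq_bigr => k _.
  by rewrite /= !trmx_mul trmxK M0.1 mulmxA.
rewrite qform_gramian lt_neqAle sumr_ge0 => [|k _]; last exact: M0.2.
rewrite andbT eq_sym; apply: contra v0 => /eqP /psumr_eq0P E.
apply/eqP/obs => j jn; apply: possemidef_qform_eq0 => //.
by apply: (E (fun k _ => M0.2 _) (Ordinal jn)).
Qed.

Lemma compensator_scaleP A M :
  0 < compensator_scale A M /\
  compensator_scale A M * (n.+1%:R + power_bound A M) <= 1.
Proof.
have p0 : 0 < n.+1%:R + power_bound A M.
  rewrite ltr_wpDr ?ltr0n // mulr_ge0 ?coercivity_bound_ge0 //.
  by rewrite addr_ge0 ?sqnormmx_ge0.
by split; [rewrite invr_gt0|rewrite mulVf ?gt_eqF].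
Qed.

(** The form at [v] is the sum in [weighted_sum_gt0], where [q k] is the squared [M]-seminorm of
    [A^k v] and [c k] pairs [A^k v] with [A^(k+2) v]. *)
Lemma compensator_posdef A M : possemidefmx M ->
  (forall v, (forall j, (j < n.+1)%N -> M *m (A ^+ j *m v) = 0) -> v = 0) ->
  posdefmx (sympart (skew_compensator A M *m A) + M).
Proof.
move=> M0 obs; have G0 := gramian_posdef M0 obs.
split=> [|v v0]; first by rewrite linearD /= sympart_sym M0.1.
have [s0 sP] := compensator_scaleP A M.
rewrite qformD qform_sympart addrC.
pose q k := qform M (A ^+ k *m v).
pose c k := bform M (A ^+ k *m v) (A ^+ k.+2 *m v).
have -> : qform M v = q 0%N by rewrite /q expr0 mul1mx.
have -> : qform (skew_compensator A M *m A) v =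
    \sum_(i < n) compensator_weight n.+1 (compensator_scale A M) i.+1
      * (q i.+1 - c i).
  have EA (X : 'M[R]_n.+1) k : X *m A ^+ k *m A = X *m A ^+ k.+1.
    by rewrite -mulmxA exprSr.
  rewrite mulmx_suml qform_sum; apply: eq_bigr => i _.
  rewrite -scalemxAl qformZ mulmxBl !EA.
  by rewrite qformD -scaleN1r qformZ !qform_congr mulN1r.
apply: weighted_sum_gt0 sP => //.
- by move=> k; exact: M0.2.
- by move=> k; exact: possemidef_cauchy_schwarz.
- by rewrite mulr_ge0 ?coercivity_bound_ge0 ?addr_ge0 ?sqnormmx_ge0.
(* [q n.+1] is at most a constant times [|v|^2], which coercivity of the Gramian bounds by the sum
   of the lower [q k]. *)
- rewrite -qform_gramian -[q _]qform_congr.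
  apply: le_trans (qform_le _ _) _.
  rewrite -mulrA ler_wpM2l ?addr_ge0 ?sqnormmx_ge0 //.
  exact: posdef_coercive.
- by rewrite -qform_gramian; exact: G0.2.
Qed.

End Compensator.

(** * Smoothness of the skew compensator *)

Section SmoothCompensator.
Context (R : realType) (d n : nat) (D : set 'rV[R]_d).
Context (A M : 'rV[R]_d -> 'M[R]_n.+1).
Hypotheses (sA : smooth_genmx D A) (sM : smooth_genmx D M).
Hypothesis gram_unit : forall x, D x -> gramian (A x) (M x) \in unitmx.

Lemma smooth_gen_powers k l :
  smooth_genmx D (fun x => (A x ^+ k)^T *m M x *m A x ^+ l).
Proof.
apply: smooth_genmx_mul (smooth_genmxX _ sA).
exact: smooth_genmx_mul (smooth_genmx_tr (smooth_genmxX _ sA)) sM.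
Qed.

Lemma smooth_gramian : smooth_genmx D (fun x => gramian (A x) (M x)).
Proof. by apply: smooth_genmx_sum => k _; exact: smooth_gen_powers. Qed.

Lemma smooth_gen_addl (f : 'rV[R]_d -> R) a :
  smooth_gen D f -> smooth_gen D (fun x => a + f x).
Proof. exact: smooth_genD (smooth_gen_cst _ _). Qed.

Lemma smooth_compensator_scale :
  smooth_gen D (fun x => compensator_scale (A x) (M x)).
Proof.
apply: smooth_genV => [x Dx|].
  by rewrite -invr_eq0 gt_eqF //; have [] := compensator_scaleP (A x) (M x).
apply: smooth_gen_addl; apply: smooth_genM.
  exact/smooth_gen_addl/smooth_gen_sqnormmx/smooth_gen_powers.
apply: smooth_genM.
  exact/smooth_gen_sqnormmx/smooth_genmx_inv/smooth_gramian.
exact/smooth_gen_addl/smooth_gen_sqnormmx/smooth_gramian.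
Qed.

Lemma smooth_skew_compensator :
  smooth_genmx D (fun x => skew_compensator (A x) (M x)).
Proof.
apply: smooth_genmx_sum => i _; apply: smooth_genmx_scale.
  exact/smooth_genX/smooth_compensator_scale.
by apply: smooth_genmx_sub; exact: smooth_gen_powers.
Qed.

End SmoothCompensator.

Lemma open_neq0 (R : realType) (d : nat) : open [set xi : 'rV[R]_d | xi != 0].
Proof.
have -> : [set xi : 'rV[R]_d | xi != 0] = ~` [set 0].
  by apply/seteqP; split=> xi /= /eqP.
apply: closed_openC; apply: accessible_closed_set1.
exact/hausdorff_accessible/norm_hausdorff.
Qed.

(** * The equivalences *)

Section Equivalences.
Context (R : realType) (d n m : nat) (L : bmultinom d m.+1 -> 'M[R]_n.+1).
Context (S : 'rV[R]_d -> 'M[R]_n.+1) (hS : symbol_symmetrizer L S).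
Let A := transport_symbol L.
Let B := viscosity_symbol L.

(** If [A psi = - mu psi] with [psi] in [ker B], then [lambda = i |xi| mu] is an eigenvalue with
    zero real part. *)
Lemma strictly_dissipative_coupled :
  strictly_dissipative L -> genuinely_coupled L.
Proof.
move=> sd xi xi0 mu psi Bpsi psi0; apply/negP => /eqP.
rewrite -/(A xi) mulmxDl mul_scalar_mx => /eqP.
rewrite addrC addr_eq0 -scaleNr => /eqP Apsi.
pose z : R[i] := ('i%C * (enorm xi)%:C)%C.
have : complex.Re (z * mu%:C)%C < 0.
  apply: (sd xi xi0); exists (complexmx psi); split.
    by rewrite map_mx_eq0.
  rewrite -/(A xi) !mulmxDl -scalemxAl mul_scalar_mx /complexmx -!map_mxM.
  rewrite Bpsi Apsi map_mxZ map_mx0 addr0 scalerA -scalerDl.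
  by rewrite rmorphN mulrN -/z subrr scale0r.
by rewrite /z /= !(mul0r, mulr0, mul1r, subr0, addr0, add0r, oppr0, ltxx).
Qed.

(** If [Re lambda >= 0], both parts of the energy identity are nonnegative and hence vanish. So
    [Re lambda = 0], and the real and imaginary parts of [v] lie in [ker B]. *)
Lemma coupled_strictly_dissipative :
  genuinely_coupled L -> strictly_dissipative L.
Proof.
move=> gc xi xi0 lambda [v [v0]].
have [_ /(_ _ xi0)[S0 SA SB SB0]] := hS.
rewrite -/(A xi) -/(B xi) in SA SB SB0 *.
have e0 := enorm_gt0 xi0; set e := enorm xi in e0 *.
set a := complex.Re lambda; pose b := complex.Im lambda.
pose x := Remx v; pose y := Immx v.
rewrite !mulmxDl -scalemxAl mul_scalar_mx => eqv.
have Rez : complex.Re ('i%C * e%:C)%C = 0 by rewrite /= !(mul0r, mulr0) subr0.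
have Imz : complex.Im ('i%C * e%:C)%C = e by rewrite /= !(mul0r, mul1r) add0r.
have eqx : a *: x - b *: y - e *: (A xi *m y) + B xi *m x = 0.
  move: (congr1 (@Remx R _ _) eqv).
  rewrite !RemxD !Remx_scale Rez Imz scale0r sub0r !Remx_mul !Immx_mul => ->.
  by apply/matrixP => i j; rewrite !mxE.
have eqy : a *: y + b *: x + e *: (A xi *m x) + B xi *m y = 0.
  move: (congr1 (@Immx R _ _) eqv).
  rewrite !ImmxD !Immx_scale Rez Imz scale0r add0r !Remx_mul !Immx_mul => ->.
  by apply/matrixP => i j; rewrite !mxE.
have bform0 u : bform (S xi) u 0 = 0 by rewrite /bform mulmx0 mxE.
have bE (X : 'M[R]_n.+1) u w : bform (S xi *m X) u w = bform (S xi) u (X *m w).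
  by rewrite /bform !mulmxA.
move: v0; rewrite complexmx_eq0 negb_and -/x -/y => xy.
have q0 : 0 < bform (S xi) x x + bform (S xi) y y.
  case/orP: xy => /(S0.2) ?; [apply: ltr_pwDl => //|apply: ltr_wpDl => //];
  exact: (posdef_semidef S0).2.
(* The real part of [v^* S (lambda + i |xi| A + B) v = 0]. *)
have energy : a * (bform (S xi) x x + bform (S xi) y y)
    + (qform (S xi *m B xi) x + qform (S xi *m B xi) y) = 0.
  have := congr1 (bform (S xi) x) eqx; have := congr1 (bform (S xi) y) eqy.
  rewrite !bform0 -!scaleNr !bformDr !bform_scaler -!bE.
  rewrite (bformC y x S0.1) (bformC y x SA) /qform /bform; lra.
rewrite ltNge; apply/negP => a0.
have Bx0 := SB0.2 x; have By0 := SB0.2 y.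
have a00 : a = 0.
  apply/eqP; rewrite eq_le a0 andbT -(pmulr_lle0 _ q0); lra.
rewrite a00 mul0r add0r in energy.
have kerB u : qform (S xi *m B xi) u = 0 -> B xi *m u = 0.
  move=> /(possemidef_qform_eq0 SB0) SBu.
  by rewrite -[B xi](mulKmx (posdef_unit S0)) -mulmxA SBu mulmx0.
have Bx : B xi *m x = 0 by apply: kerB; lra.
have By : B xi *m y = 0 by apply: kerB; lra.
(* The two equations decouple: [x] and [y] each satisfy [b u + |xi| A u = 0], which contradicts
   coupling with [mu = b / |xi|]. *)
rewrite a00 Bx scale0r sub0r addr0 -opprD in eqx.
rewrite a00 By scale0r add0r addr0 in eqy.
have eigen (u : 'cV[R]_n.+1) :
    B xi *m u = 0 -> u != 0 -> b *: u + e *: (A xi *m u) = 0 -> False.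
  move=> Bu u0 bu; have := gc xi xi0 (e^-1 * b) u Bu u0.
  have -> : ((e^-1 * b)%:M + A xi) *m u = e^-1 *: (b *: u + e *: (A xi *m u)).
    rewrite mulmxDl mul_scalar_mx scalerDr !scalerA mulVf ?scale1r //.
    by rewrite gt_eqF.
  by rewrite bu scaler0 eqxx.
case/orP: xy => u0; [exact: eigen eqy|apply: (eigen y) => //].
by apply/eqP; rewrite -oppr_eq0 eqx.
Qed.

(** At an eigenvector [psi] of [A] in [ker B] the forms of [K S A] and [S B] both vanish, which
    leaves [- theta |psi|^2 >= 0]. *)
Lemma compensating_coupled K :
  compensating_symbol S A B K -> genuinely_coupled L.
Proof.
move=> [_ hK] xi xi0 mu psi Bpsi psi0; apply/negP => /eqP.
rewrite -/(A xi) mulmxDl mul_scalar_mx => /eqP.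
rewrite addrC addr_eq0 -scaleNr => /eqP Apsi.
have [KS [theta [theta0 [_ /(_ psi)]]]] := hK xi xi0.
have KS0 : bform (K xi *m S xi) psi psi = 0.
  have := qform_tr (K xi *m S xi) psi.
  by rewrite KS -scaleN1r qformZ /qform -/(bform _ _ _); lra.
rewrite qform_sub_scalar qformD qform_sympart.
have -> : qform (K xi *m S xi *m A xi) psi = 0.
  have -> : qform (K xi *m S xi *m A xi) psi
      = bform (K xi *m S xi) psi (A xi *m psi) by rewrite /qform /bform !mulmxA.
  by rewrite Apsi bform_scaler KS0 mulr0.
have -> : qform (S xi *m B xi) psi = 0.
  by rewrite /qform -!mulmxA Bpsi !mulmx0 mxE.
by rewrite add0r sub0r oppr_ge0 leNgt mulr_gt0 // sqnormmx_cV_gt0.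
Qed.

Lemma coupled_compensating :
  genuinely_coupled L -> exists K, compensating_symbol S A B K.
Proof.
move=> gc; have [sS hS'] := hS.
pose M xi := S xi *m B xi.
have posS xi : xi != 0 -> posdefmx (S xi) by move=> /hS'[].
have M0 xi : xi != 0 -> possemidefmx (M xi) by move=> /hS'[].
have obs xi : xi != 0 -> forall v : 'cV[R]_n.+1,
    (forall j, (j < n.+1)%N -> M xi *m (A xi ^+ j *m v) = 0) -> v = 0.
  move=> xi0 v Mv; have [S0 SA _ _] := hS' xi xi0.
  apply: (coupled_observable S0 SA (gc xi xi0)) => j jn.
  (* Since [B = S^-1 M], a vector killed by [M] is killed by [B]. *)
  rewrite -[viscosity_symbol L xi](mulKmx (posdef_unit S0)) -mulmxA.
  by rewrite [_ *m _ *m (_ *m _)]Mv // mulmx0.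
exists (fun xi => skew_compensator (A xi) (M xi) *m invmx (S xi)); split.
  move=> i j; apply: smooth_gen_smooth_on; first exact: open_neq0.
  have sS' : smooth_genmx [set xi | xi != 0] S.
    by move=> k l; apply: smooth_gen_smooth; exact: sS.
  have sM : smooth_genmx [set xi | xi != 0] M.
    exact: smooth_genmx_mul sS' (smooth_viscosity_symbol L).
  move: i j; apply: smooth_genmx_mul.
    apply: (smooth_skew_compensator (smooth_transport_symbol L) sM) => xi xi0.
    exact/posdef_unit/gramian_posdef/obs/xi0/M0.
  by apply: smooth_genmx_inv sS' => xi /posS; exact: posdef_unit.
move=> xi xi0.
have -> : skew_compensator (A xi) (M xi) *m invmx (S xi) *m S xi
    = skew_compensator (A xi) (M xi).
  by rewrite mulmxKV //; apply: posdef_unit; exact: posS.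
split; first by apply: skew_compensator_skew; exact: (M0 _ xi0).1.
by apply: posdef_lower_bound; apply: compensator_posdef; [exact: M0|exact: obs].
Qed.

End Equivalences.

Theorem theorem3p3 (R : realType) (d n m : nat) (hd : (2 <= d)%N)
    (hn : (1 <= n)%N) (L : bmultinom d m.+1 -> 'M[R]_n)
    (S : 'rV[R]_d -> 'M[R]_n) (hS : symbol_symmetrizer L S) :
  (strictly_dissipative L <-> genuinely_coupled L) /\
  (genuinely_coupled L <->
     exists K : 'rV[R]_d -> 'M[R]_n,
       compensating_symbol S (transport_symbol L) (viscosity_symbol L) K).
Proof.
case: n hn L S hS => [//|n] _ L S hS; split; split.
- exact: strictly_dissipative_coupled.
- exact: coupled_strictly_dissipative hS.
- exact: coupled_compensating hS.
- by case=> K; exact: compensating_coupled.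
Qed.
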